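(* For any non-empty open subset $\tilde\Omega\subset\mathbb R^3$, for any non-empty open subset $\Omega$ of $\tilde\Omega$, for any $(u,p)\in C^\infty(\tilde\Omega;\mathbb R^3\times\mathbb R)$ satisfying $\Delta u=\nabla p$ and $\operatorname{div}u=0$ in $\tilde\Omega$ and $(u,p)=0$ in $\Omega$, one has $(u,p)=0$ in $\tilde\Omega$.
   Context: Here $u$ is $\mathbb R^3$-valued, $p$ is real-valued, and $\Delta u$ is the componentwise Laplacian.
   Formalization: The larger open set Ω̃ is additionally assumed connected; without this the claim fails, e.g. for Ω̃ a union of two disjoint balls, Ω one of them, u=0, and p equal to 0 on Ω and 1 on the other ball. *)

(* Defs.v *)
From HB Require Import structures.
From mathcomp Require Import all_boot all_order all_algebra.
From mathcomp Require Import all_classical all_reals topology normedtype derive.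

Set Implicit Arguments.
Unset Strict Implicit.
Unset Printing Implicit Defensive.

Import Order.TTheory GRing.Theory Num.Theory.
Import numFieldNormedType.Exports.

Local Open Scope classical_set_scope.
Local Open Scope ring_scope.

(* Functions on an open set D of R^n are represented by total functions on
   'rV[R]_n; their values outside D are irrelevant, since derivatives and
   continuity at a point of D only depend on values near that point. *)

Definition partial (R : realType) (n : nat) (V : normedModType R) (i : 'I_n)
    (f : 'rV[R]_n -> V) : 'rV[R]_n -> V :=
  'D_(delta_mx 0 i) f.

(* iter_partial [:: i1; ...; ik] f is d_i1 (d_i2 ( ... (d_ik f))). *)
Definition iter_partial (R : realType) (n : nat) (V : normedModType R)
    (s : seq 'I_n) (f : 'rV[R]_n -> V) : 'rV[R]_n -> V :=
  foldr (fun i g => partial i g) f s.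

(* For D open, this is C^oo(D; V): partial derivatives of every order exist
   and are continuous at every point of D.  Existence is stated separately
   because 'D_v f x is a default value when f is not derivable at x. *)
Definition smooth_on (R : realType) (n : nat) (V : normedModType R)
    (D : set 'rV[R]_n) (f : 'rV[R]_n -> V) : Prop :=
  forall (s : seq 'I_n) (x : 'rV[R]_n), D x ->
    {for x, continuous (iter_partial s f)} /\
    forall i : 'I_n, derivable (iter_partial s f) x (delta_mx 0 i).

Definition gradient (R : realType) (n : nat) (p : 'rV[R]_n -> R)
    (x : 'rV[R]_n) : 'rV[R]_n :=
  \row_i partial i p x.

Definition divergence (R : realType) (n : nat) (u : 'rV[R]_n -> 'rV[R]_n)
    (x : 'rV[R]_n) : R :=
  \sum_i partial i (fun y => u y 0 i) x.

Definition laplacian (R : realType) (n : nat) (f : 'rV[R]_n -> R)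
    (x : 'rV[R]_n) : R :=
  \sum_i partial i (partial i f) x.

Definition vlaplacian (R : realType) (n m : nat) (u : 'rV[R]_n -> 'rV[R]_m)
    (x : 'rV[R]_n) : 'rV[R]_m :=
  \row_j laplacian (fun y => u y 0 j) x.

(* Main.v *)
(* Taking the divergence of the Stokes equation shows that p is harmonic, so it
   is enough to know unique continuation for harmonic functions: then p = 0, and
   each component of u is harmonic and vanishes in turn.

   For the maximum norm, whose balls are cubes, comparing the odd part of f in
   one coordinate with an explicit barrier on a half cube gives
   |d_k f(z)| <= (n+1)/d * sup |f| over the cube of radius d.  Iterating k times
   on cubes shrinking by r/(2k), Taylor's formula and k^k <= 4^k k! show that a
   harmonic function vanishing near z vanishes on axis-parallel segments from z
   of a length proportional to r.  Moving along the axes one after the other,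
   the interior of the zero set is relatively closed in the domain. *)

Require Import Defs.
From HB Require Import structures.
From mathcomp Require Import all_boot all_order all_algebra.
From mathcomp Require Import all_classical all_reals topology normedtype derive.
From mathcomp Require Import realfun ring.

Import Order.TTheory GRing.Theory Num.Theory.
Import numFieldNormedType.Exports.

Local Open Scope classical_set_scope.
Local Open Scope ring_scope.

(** * Derivatives along lines, under translations and under linear maps *)

Lemma is_derive_line (R : realType) (V W : normedModType R) (f : V -> W)
    (x e : V) (t : R) :
  derivable f (x + t *: e) e ->
  is_derive t 1 (fun s => f (x + s *: e)) ('D_e f (x + t *: e)).
Proof.
have lineE : (fun h => h^-1 *: (((fun s => f (x + s *: e)) \o shift t) (h *: 1)
    - f (x + t *: e))) =
  (fun h => h^-1 *: ((f \o shift (x + t *: e)) (h *: e) - f (x + t *: e))).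
  apply/funext => h /=; rewrite [h%:A]mulr1; congr (_ *: (f _ - _)).
  by rewrite scalerDl addrCA.
by move=> df; split; rewrite /derivable /derive lineE.
Qed.

Lemma is_derive_translate (R : realType) (V W : normedModType R) (f : V -> W)
    (a x v : V) :
  derivable f (x + a) v -> is_derive x v (fun y => f (y + a)) ('D_v f (x + a)).
Proof.
have shiftE : (fun h => h^-1 *: (((fun y => f (y + a)) \o shift x) (h *: v)
    - f (x + a))) =
  (fun h => h^-1 *: ((f \o shift (x + a)) (h *: v) - f (x + a))).
  by apply/funext => h /=; rewrite addrA.
by move=> df; split; rewrite /derivable /derive shiftE.
Qed.

(** Linearity moves [L] across the difference quotient, and continuity moves it across the limit. *)
Lemma is_derive_linear_comp (R : realType) (U V W : normedModType R)
    (L : V -> W) (f : U -> V) (x v : U) : linear L -> continuous L ->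
  derivable f x v -> is_derive x v (L \o f) (L ('D_v f x)).
Proof.
move=> linL contL df.
have quotE : (fun h => h^-1 *: (((L \o f) \o shift x) (h *: v) - (L \o f) x)) =
    L \o (fun h => h^-1 *: ((f \o shift x) (h *: v) - f x)).
  apply/funext => h /=.
  by rewrite (GRing.scalable_linear linL) (GRing.zmod_morphism_linear linL).
have cL : L \o (fun h => h^-1 *: ((f \o shift x) (h *: v) - f x)) @ 0^'
    --> L ('D_v f x) by apply: continuous_cvg; [exact: contL|exact: df].
split; rewrite /derivable /derive quotE; last exact: cvg_lim.
by apply/cvg_ex; exists (L ('D_v f x)).
Qed.

(* Without this, unification unfolds derivatives into limits. *)
Local Opaque derive derivable.

(** * Mean values and the symmetry of mixed derivatives *)

Lemma MVT_from0 (R : realType) (g dg : R -> R) (h : R) : 0 < h ->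
  (forall t, 0 <= t <= h -> is_derive t 1 g (dg t)) ->
  exists2 c, 0 < c < h & g h - g 0 = dg c * h.
Proof.
move=> h0 dgP.
have dgP1 t : t \in `]0, h[%R -> is_derive t 1 g (dg t).
  by rewrite in_itv/= => /andP[t0 th]; apply: dgP; rewrite !ltW.
have cg : {within `[0, h], continuous g}.
  apply: derivable_within_continuous => t.
  by rewrite in_itv/= => /dgP dgt; exact: ex_derive.
have [c] := MVT h0 dgP1 cg.
by rewrite in_itv/= subr0; exists c.
Qed.

Lemma MVT_line (R : realType) (V : normedModType R) (f : V -> R)
    (x e : V) (h : R) : 0 < h ->
  (forall t, 0 <= t <= h -> derivable f (x + t *: e) e) ->
  exists2 c, 0 <= c <= h & f (x + h *: e) - f x = 'D_e f (x + c *: e) * h.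
Proof.
move=> h0 df.
have df' t : 0 <= t <= h ->
    is_derive t 1 (fun s => f (x + s *: e)) ('D_e f (x + t *: e)).
  by move=> th; apply: is_derive_line; exact: df.
have [c /andP[c0 ch]] := MVT_from0 _ _ _ _ h0 df'.
by rewrite scale0r addr0; exists c; rewrite ?ltW.
Qed.

(** Two applications of the mean value theorem: to the increment [g] of [f] in direction [e2],
    moving along [e1], then to ['D_e1 f], moving along [e2]. *)
Lemma mixed_difference (R : realType) (V : normedModType R) (f : V -> R)
    (x e1 e2 : V) (h : R) : 0 < h ->
  (forall s t, 0 <= s <= h -> 0 <= t <= h ->
    [/\ derivable f (x + s *: e1 + t *: e2) e1 &
        derivable ('D_e1 f) (x + s *: e1 + t *: e2) e2]) ->
  exists s, exists t, [/\ 0 <= s <= h, 0 <= t <= h &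
    f (x + h *: e1 + h *: e2) - f (x + h *: e1) - f (x + h *: e2) + f x =
    'D_e2 ('D_e1 f) (x + s *: e1 + t *: e2) * h * h].
Proof.
move=> h0 df; pose g y := f (y + h *: e2) - f y.
have h0h : 0 <= h <= h by rewrite lexx ltW.
have z0h : 0 <= (0 : R) <= h by rewrite lexx ltW.
have dg s : 0 <= s <= h -> is_derive (x + s *: e1) e1 g
    ('D_e1 f (x + s *: e1 + h *: e2) - 'D_e1 f (x + s *: e1)).
  move=> sh; apply: is_deriveB.
    by case: (df s h sh h0h) => d _; exact: (is_derive_translate _ _ _ f).
  have [] := df s 0 sh z0h; rewrite scale0r addr0 => d _.
  exact: derivableP.
have [s sh Es] : exists2 s, 0 <= s <= h &
    g (x + h *: e1) - g x = 'D_e1 g (x + s *: e1) * h.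
  by apply: (MVT_line _ _ _ _ _ _ h0) => s /dg ds; exact: ex_derive.
have [t th Et] : exists2 t, 0 <= t <= h &
    'D_e1 f (x + s *: e1 + h *: e2) - 'D_e1 f (x + s *: e1) =
    'D_e2 ('D_e1 f) (x + s *: e1 + t *: e2) * h.
  apply: (MVT_line _ _ ('D_e1 f) (x + s *: e1) e2 _ h0) => t th.
  by case: (df s t sh th).
exists s, t; split => //.
rewrite -Et -(@derive_val _ _ _ _ _ _ _ (dg s sh)) -Es /g; ring.
Qed.

Lemma dist_le_split (R : realFieldType) (a b c d e : R) :
  `|a - c| <= e / 2 -> `|b - d| <= e / 2 -> c = d -> `|a - b| <= e.
Proof.
move=> ac bd cd; rewrite (splitr e) (le_trans (ler_distD c _ _))// lerD//.
by rewrite cd distrC.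
Qed.

(** The second difference of [f] over a parallelogram is symmetric in [e1] and [e2]. Hence the two
    mixed derivatives take a common value at two possibly different points near [x], and continuity
    at [x] brings both values back to [x]. *)
Lemma derive_comm (R : realType) (V : normedModType R) (f : V -> R)
    (x e1 e2 : V) :
  (\forall y \near x, [/\ derivable f y e1, derivable f y e2,
    derivable ('D_e1 f) y e2 & derivable ('D_e2 f) y e1]) ->
  {for x, continuous ('D_e2 ('D_e1 f))} ->
  {for x, continuous ('D_e1 ('D_e2 f))} ->
  'D_e2 ('D_e1 f) x = 'D_e1 ('D_e2 f) x.
Proof.
move=> df c21 c12; apply/eqP; rewrite -subr_eq0 -normr_le0.
apply/ler_addgt0Pr => e e0; rewrite add0r.
have e20 : 0 < e / 2 by rewrite divr_gt0.
have near21 : \forall y \near x,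
    `|'D_e2 ('D_e1 f) x - 'D_e2 ('D_e1 f) y| <= e / 2.
  by move/cvgrPdist_le : c21 => /(_ _ e20).
have near12 : \forall y \near x,
    `|'D_e1 ('D_e2 f) x - 'D_e1 ('D_e2 f) y| <= e / 2.
  by move/cvgrPdist_le : c12 => /(_ _ e20).
have [r /= r0 hr] := (nbhs_ballP _ _).1 (filterI df (filterI near21 near12)).
have N0 : 0 < `|e1| + `|e2| + 1 by rewrite ltr_wpDl// addr_ge0.
pose h := r / (`|e1| + `|e2| + 1).
have h0 : 0 < h by rewrite divr_gt0.
have close s t : 0 <= s <= h -> 0 <= t <= h ->
    ball x r (x + s *: e1 + t *: e2).
  move=> /andP[s0 sh] /andP[t0 th].
  rewrite -ball_normE/= -addrA opprD addNKr normrN.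
  rewrite (le_lt_trans (ler_normD _ _))// !normrZ !ger0_norm//.
  have : s * `|e1| + t * `|e2| <= h * (`|e1| + `|e2|).
    by rewrite mulrDr lerD// ler_wpM2r.
  move=> /le_lt_trans; apply.
  by rewrite -[ltRHS](divfK (lt0r_neq0 N0)) -/h ltr_pM2l// ltrDl.
have [s [t [sh th Est]]] : exists s, exists t, [/\ 0 <= s <= h, 0 <= t <= h &
    f (x + h *: e1 + h *: e2) - f (x + h *: e1) - f (x + h *: e2) + f x =
    'D_e2 ('D_e1 f) (x + s *: e1 + t *: e2) * h * h].
  apply: (mixed_difference _ _ _ _ _ _ _ h0) => s t sh th.
  by have [[]] := hr _ (close s t sh th).
have [s' [t' [sh' th' Est']]] : exists s, exists t,
    [/\ 0 <= s <= h, 0 <= t <= h &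
    f (x + h *: e2 + h *: e1) - f (x + h *: e2) - f (x + h *: e1) + f x =
    'D_e1 ('D_e2 f) (x + s *: e2 + t *: e1) * h * h].
  apply: (mixed_difference _ _ _ _ _ _ _ h0) => s' t' sh' th'.
  rewrite addrAC; case: (hr _ (close t' s' th' sh')) => -[_ d2 _ d1] _.
  by split; [exact: d2 | exact: d1].
(* Both sides times [h * h] equal the same second difference. *)
have E : 'D_e2 ('D_e1 f) (x + s *: e1 + t *: e2) =
         'D_e1 ('D_e2 f) (x + t' *: e1 + s' *: e2).
  rewrite (addrAC x (t' *: e1)).
  have cancel (a b l l' : R) :
      l = l' -> l = a * h * h -> l' = b * h * h -> a = b.
    by move=> -> -> ab; do 2 apply: (mulIf (lt0r_neq0 h0)).
  by apply: cancel Est Est'; rewrite (addrAC x (h *: e2)); ring.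
have [_ [n21 _]] := hr _ (close s t sh th).
have [_ [_ n12]] := hr _ (close t' s' th' sh').
exact: (dist_le_split _ _ _ _ _ _ n21 n12 E).
Qed.

(** * One-variable tools: second derivative test, chain rule on a line, Taylor bound *)

(** At the maximum [dg 0 = 0]. If [a] were positive, [dg] would be positive just to the right of 0,
    and the mean value theorem would give [g h > g 0] for a small [h > 0]. *)
Lemma second_derivative_test (R : realType) (g dg : R -> R) (a : R) :
  (\forall t \near (0 : R), is_derive (t : R) (1 : R) g (dg t)) ->
  is_derive (0 : R) (1 : R) dg a ->
  (\forall t \near (0 : R), g t <= g 0) -> a <= 0.
Proof.
move=> ng dga gmax; rewrite leNgt; apply/negP => a0.
have [r /= r0 hr] := (nbhs_ballP _ _).1 (filterI ng gmax).
have {}hr (t : R) : t \in `]- r, r[%R -> is_derive t 1 g (dg t) /\ g t <= g 0.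
  rewrite in_itv/= => tr; apply: hr.
  by rewrite -ball_normE/= sub0r normrN ltr_norml.
have z0 : (0 : R) \in `]- r, r[%R by rewrite in_itv/= oppr_lt0 r0.
have rr : - r <= r by rewrite ge0_cp// ltW.
have dg0 : dg 0 = 0.
  have H : is_derive (0 : R) (1 : R) g 0.
    have dg1 (t : R) : t \in `]- r, r[%R -> derivable g t 1.
      by case/hr=> -[].
    by apply: (derive1_at_max rr dg1 z0) => t /hr[].
  have [H0 _] := hr _ z0; rewrite -(@derive_val _ _ _ _ _ _ _ H0).
  by rewrite (@derive_val _ _ _ _ _ _ _ H).
have : (fun h => h^-1 *: ((dg \o shift 0) (h *: 1) - dg 0)) @ 0^' --> a.
  by case: dga => + <-.
move=> /cvgr_gt/(_ _ a0)[q /= q0 hq].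
pose h := Num.min r q / 2.
have h0 : 0 < h by rewrite divr_gt0// lt_min r0 q0.
have hrq : h < Num.min r q by rewrite ltr_pdivrMr// ltr_pMr ?ltr1n// lt_min r0.
have [hr' hq'] : h < r /\ h < q.
  by split; apply: (lt_le_trans hrq); rewrite ge_min lexx ?orbT.
have itv c : 0 <= c <= h -> c \in `]- r, r[%R.
  move=> /andP[c0 ch]; rewrite in_itv/= (lt_le_trans _ c0) ?oppr_lt0//=.
  exact: le_lt_trans hr'.
have [|c /andP[c0 ch] Ec] := MVT_from0 _ g dg _ h0.
  by move=> t /itv/hr[].
have h_itv : h \in `]- r, r[%R by apply: itv; rewrite lexx ltW.
have [_] := hr h h_itv.
rewrite -subr_le0 Ec pmulr_lle0//; apply/negP; rewrite -ltNge.
have := hq c; rewrite /= sub0r normrN gtr0_norm// => /(_ (lt_trans ch hq')).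
rewrite gt_eqF// => /(_ isT).
by rewrite addr0 dg0 subr0 [_%:A]mulr1 /GRing.scale/= pmulr_rgt0 ?invr_gt0.
Qed.
(** The factor [s] will be a sign: it reverses a line under reflection, or orients a segment so that
    its parameter is nonnegative. *)
Lemma is_derive_line_scale (R : realType) (V : normedModType R) (f : V -> R)
    (x e : V) (s t : R) :
  derivable f (x + (s * t) *: e) e ->
  is_derive t 1 (fun r => f (x + (s * r) *: e))
    ('D_e f (x + (s * t) *: e) * s).
Proof.
move=> df; apply: (@is_derive1_comp _ (fun r => f (x + r *: e)) ( *%R s)).
  exact: is_derive_line.
have ds : is_derive t 1 (s \*: (@idfun R)) (s *: 1) by apply: is_deriveZ.
by rewrite [s *: 1]mulr1 in ds.
Qed.

(** Induction on [k]: the bound on [g 1] is integrated once, by comparing [g 0] and its opposite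
    with a multiple of [t ^+ k.+1]. The family [g] stands for the successive derivatives of
    [g 0]. *)
Lemma taylor_bound (R : realType) (g : nat -> R -> R) (A h : R) (k : nat) :
  (forall (j : nat) (t : R), (j < k)%N -> 0 <= t <= h ->
    is_derive t 1 (g j) (g j.+1 t)) ->
  (forall j, (j < k)%N -> g j 0 = 0) ->
  (forall t, 0 <= t <= h -> `|g k t| <= A) ->
  forall t, 0 <= t <= h -> `|g 0%N t| <= A / k`!%:R * t ^+ k.
Proof.
elim: k g => [|k IH] g dg g0 gk t th.
  by rewrite divr1 expr0 mulr1; exact: gk.
have {}IH s : 0 <= s <= h -> `|g 1%N s| <= A / k`!%:R * s ^+ k.
  apply: (IH (fun j => g j.+1)) => // j.
    by move=> r jk; exact: dg.
  by move=> jk; exact: g0.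
have [t0 th'] := andP th.
(* The mean value theorem needs a segment of positive length. *)
have [<-|t_neq0] := eqVneq 0 t.
  by rewrite g0// expr0n mulr0 normr0.
have {t_neq0}t0 : 0 < t by rewrite lt_neqAle t_neq0.
set B := A / k.+1`!%:R.
have BE : B * k.+1%:R = A / k`!%:R.
  by rewrite /B factS natrM invfM mulrA mulrAC divfK// pnatr_eq0.
(* One-sided comparison, used for [g 0] and for [- g 0]: the difference [B * s ^+ k.+1 - f s]
   vanishes at 0 and has a nonnegative derivative. *)
have upper (f df : R -> R) : f 0 = 0 ->
    (forall s, 0 <= s <= h -> is_derive s 1 f (df s)) ->
    (forall s, 0 <= s <= h -> df s <= A / k`!%:R * s ^+ k) ->
    f t <= B * t ^+ k.+1.
  move=> f0 fP dfP.
  have FP s : 0 <= s <= t -> is_derive s 1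
      (B \*: (@GRing.exp R ^~ k.+1) - f) (A / k`!%:R * s ^+ k - df s).
    move=> /andP[s0 st]; apply: is_deriveB; last first.
      by apply: fP; rewrite s0 (le_trans st).
    have ds : is_derive s 1 (@GRing.exp R ^~ k.+1) (k.+1%:R * s ^+ k).
      split; first exact: exprn_derivable.
      by rewrite exp_derive [_ *: 1]mulr1.
    by rewrite -BE -mulrA; exact: is_deriveZ.
  have [c /andP[c0 ct] Ec] := MVT_from0 _ _ _ _ t0 FP.
  have {}Ec : B * t ^+ k.+1 - f t = (A / k`!%:R * c ^+ k - df c) * t.
    rewrite -Ec -[RHS]/(B * t ^+ k.+1 - f t - (B * 0 ^+ k.+1 - f 0)).
    by rewrite f0 expr0n mulr0 !subr0.
  rewrite -subr_ge0 [X in 0 <= X]Ec mulr_ge0 ?(ltW t0)// subr_ge0 dfP//.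
  by rewrite ltW// (le_trans (ltW ct)).
rewrite ler_norml; apply/andP; split; last first.
  apply: (upper _ (g 1%N)) => [|s sh|s sh]; rewrite ?g0//; first exact: dg.
  by rewrite (le_trans (ler_norm _))// IH.
rewrite lerNl; apply: (upper (- g 0%N) (- g 1%N)) => [|s sh|s sh].
- by rewrite fctE g0// oppr0.
- by apply: is_deriveN; exact: dg.
- by rewrite fctE (le_trans _ (IH _ sh))// -normrN ler_norm.
Qed.

(** * Partial derivatives of smooth and harmonic functions *)

Lemma eq_partial (R : realType) (n : nat) (V : normedModType R)
    (D : set 'rV[R]_n) (f g : 'rV[R]_n -> V) (i : 'I_n) (x : 'rV[R]_n) :
  open D -> (forall y, D y -> f y = g y) -> D x ->
  partial i f x = partial i g x.
Proof.
move=> oD fg Dx; apply: near_eq_derive.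
by apply: filterS (open_nbhs_nbhs (conj oD Dx)) => y; exact: fg.
Qed.

Lemma partial_near0 (R : realType) (n : nat) (f : 'rV[R]_n -> R) (k : 'I_n)
    (x : 'rV[R]_n) :
  (\forall y \near x, f y = 0) -> \forall y \near x, partial k f y = 0.
Proof.
move=> /nbhs_interior; apply: filterS => y fy0.
rewrite /partial -[RHS](derive_cst (0 : R) y (delta_mx 0 k)).
exact: near_eq_derive.
Qed.

Lemma smooth_continuous (R : realType) (n : nat) (V : normedModType R)
    (D : set 'rV[R]_n) (f : 'rV[R]_n -> V) (x : 'rV[R]_n) :
  smooth_on D f -> D x -> {for x, continuous f}.
Proof. by move=> sf /(sf [::])[]. Qed.

Lemma smooth_derivable (R : realType) (n : nat) (V : normedModType R)
    (D : set 'rV[R]_n) (f : 'rV[R]_n -> V) (x : 'rV[R]_n) (i : 'I_n) :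
  smooth_on D f -> D x -> derivable f x (delta_mx 0 i).
Proof. by move=> sf /(sf [::])[_]; apply. Qed.

Lemma smooth_partial (R : realType) (n : nat) (V : normedModType R)
    (D : set 'rV[R]_n) (f : 'rV[R]_n -> V) (i : 'I_n) :
  smooth_on D f -> smooth_on D (partial i f).
Proof.
move=> sf s x Dx.
have -> : iter_partial s (partial i f) = iter_partial (rcons s i) f.
  by rewrite /iter_partial foldr_rcons.
exact: sf.
Qed.

(** Iterated partial derivatives commute with [L] at the points of [D]. As [D] is open, these
    equalities hold near each point, so continuity and derivability transfer. This extracts [p] and
    the components of [u] from the pair. *)
Lemma smooth_linear_comp (R : realType) (n : nat) (V W : normedModType R)
    (L : V -> W) (D : set 'rV[R]_n) (f : 'rV[R]_n -> V) :
  linear L -> continuous L -> open D -> smooth_on D f -> smooth_on D (L \o f).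
Proof.
move=> linL contL oD sf.
have iterE s x : D x -> iter_partial s (L \o f) x = L (iter_partial s f x).
  elim: s x => [//|i s IH] x Dx /=.
  rewrite (eq_partial _ _ _ _ _ (L \o iter_partial s f) _ _ oD)//.
  have [_ /(_ i) df] := sf s x Dx.
  by have [_] := is_derive_linear_comp _ _ _ _ L _ _ _ linL contL df.
have nearE s x : D x ->
    \forall y \near x, L (iter_partial s f y) = iter_partial s (L \o f) y.
  move=> Dx; apply: filterS (open_nbhs_nbhs (conj oD Dx)) => y Dy.
  by rewrite iterE.
move=> s x Dx; have [cf df] := sf s x Dx; split=> [|i].
  suff : iter_partial s (L \o f) @ x --> iter_partial s (L \o f) x by [].
  rewrite (iterE s x Dx); apply: cvg_trans (near_eq_cvg (nearE s x Dx)) _.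
  by apply: continuous_cvg; [exact: contL | exact: cf].
apply: near_eq_derivable (nearE s x Dx) _.
by case: (is_derive_linear_comp _ _ _ _ L _ _ _ linL contL (df i)).
Qed.

Lemma partial_comm (R : realType) (n : nat) (D : set 'rV[R]_n)
    (f : 'rV[R]_n -> R) (i j : 'I_n) (x : 'rV[R]_n) :
  open D -> smooth_on D f -> D x ->
  partial i (partial j f) x = partial j (partial i f) x.
Proof.
move=> oD sf Dx; apply: derive_comm.
- apply: filterS (open_nbhs_nbhs (conj oD Dx)) => y Dy; split.
  + exact: smooth_derivable sf Dy.
  + exact: smooth_derivable sf Dy.
  + exact: smooth_derivable (smooth_partial _ _ _ _ _ j sf) Dy.
  + exact: smooth_derivable (smooth_partial _ _ _ _ _ i sf) Dy.
- by case: (sf [:: i; j] x Dx).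
- by case: (sf [:: j; i] x Dx).
Qed.

Lemma partial_sum (R : realType) (n m : nat) (D : set 'rV[R]_n)
    (f : 'I_m -> 'rV[R]_n -> R) (i : 'I_n) (x : 'rV[R]_n) :
  (forall k, smooth_on D (f k)) -> D x ->
  partial i (fun y => \sum_k f k y) x = \sum_k partial i (f k) x.
Proof.
move=> sf Dx; rewrite /partial.
have -> : (fun y => \sum_k f k y) = \sum_k f k.
  by apply/funext => y; rewrite fct_sumE.
rewrite derive_sum// => k; exact: smooth_derivable (sf k) Dx.
Qed.

Local Opaque partial.

Lemma laplacian_partial (R : realType) (n : nat) (D : set 'rV[R]_n)
    (f : 'rV[R]_n -> R) (k : 'I_n) (x : 'rV[R]_n) :
  open D -> smooth_on D f -> D x ->
  laplacian (partial k f) x = partial k (laplacian f) x.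
Proof.
move=> oD sf Dx; rewrite /laplacian.
transitivity (\sum_i partial k (partial i (partial i f)) x); last first.
  have sff i : smooth_on D (partial i (partial i f)).
    by do 2 apply: smooth_partial.
  by rewrite (partial_sum _ _ _ _ _ _ _ sff Dx).
apply: eq_bigr => i _.
have comm_k (g : 'rV[R]_n -> R) : smooth_on D g -> forall y, D y ->
    partial i (partial k g) y = partial k (partial i g) y.
  by move=> sg y Dy; apply: (partial_comm _ _ _ _ _ _ _ oD sg Dy).
have sfi : smooth_on D (partial i f) by exact: smooth_partial.
rewrite -(comm_k (partial i f) sfi x Dx).
(* The inner swap takes place under a derivative, so it is needed on all of [D] and not only at
   [x]. *)
apply: (eq_partial _ _ _ D (partial i (partial k f)) (partial k (partial i f))
  _ _ oD _ Dx).
exact: comm_k.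
Qed.

Definition harmonic_on {R : realType} {n : nat} (D : set 'rV[R]_n)
    (f : 'rV[R]_n -> R) : Prop :=
  smooth_on D f /\ forall x, D x -> laplacian f x = 0.

Lemma harmonic_partial (R : realType) (n : nat) (D : set 'rV[R]_n)
    (f : 'rV[R]_n -> R) (k : 'I_n) :
  open D -> harmonic_on D f -> harmonic_on D (partial k f).
Proof.
move=> oD [sf lf]; split=> [|x Dx]; first exact: smooth_partial.
rewrite (laplacian_partial _ _ _ _ _ _ oD sf Dx).
rewrite (eq_partial _ _ _ _ _ (cst 0) _ _ oD lf Dx).
exact: derive_cst.
Qed.

(** * The maximum norm, its cubes, slopes and quadratics *)

Lemma coord_norm_le (R : realType) (n : nat) (x : 'rV[R]_n) (i : 'I_n) :
  `|x 0 i| <= `|x|.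
Proof.
rewrite [leRHS]/Num.Def.normr/= mx_normrE.
exact: (le_bigmax _ (fun ij => `|x ij.1 ij.2|) (0, i)).
Qed.

Lemma rV_norm_le (R : realType) (n : nat) (x : 'rV[R]_n) (r : R) :
  0 <= r -> (forall i, `|x 0 i| <= r) -> `|x| <= r.
Proof.
move=> r0 xr; rewrite [leLHS]/Num.Def.normr/= mx_normrE.
by rewrite bigmax_le// => -[i j] _; rewrite (ord1 i); exact: xr.
Qed.

Lemma rV_norm_lt (R : realType) (n : nat) (x : 'rV[R]_n) (r : R) :
  0 < r -> (forall i, `|x 0 i| < r) -> `|x| < r.
Proof.
move=> r0 xr; rewrite [ltLHS]/Num.Def.normr/= mx_normrE.
by rewrite bigmax_lt// => -[i j] _; rewrite (ord1 i); exact: xr.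
Qed.

Lemma norm_delta_le1 (R : realType) (n : nat) (i : 'I_n) :
  `|delta_mx 0 i : 'rV[R]_n| <= 1.
Proof.
apply: rV_norm_le => // j; rewrite mxE eqxx /=.
by case: eqP; rewrite ?normr1 ?normr0.
Qed.

(** A bound to the right of 0 is enough, since the derivative is also the limit of the quotients
    with [h > 0]. *)
Lemma derive_le_of_slope (R : realType) (g : R -> R) (a C d : R) :
  0 < d -> is_derive (0 : R) (1 : R) g a -> g 0 = 0 ->
  (forall t, 0 < t <= d -> g t <= C * t) -> a <= C.
Proof.
move=> d0 dga g0 gC; rewrite leNgt; apply/negP => Ca.
have : (fun h => h^-1 *: ((g \o shift 0) (h *: 1) - g 0)) @ 0^' --> a.
  by case: dga => + <-.
move=> /cvgr_gt/(_ _ Ca)[q /= q0 hq].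
pose h := Num.min d q / 2.
have h0 : 0 < h by rewrite divr_gt0// lt_min d0 q0.
have hdq : h < Num.min d q by rewrite ltr_pdivrMr// ltr_pMr ?ltr1n// lt_min d0.
have [hd' hq'] : h < d /\ h < q.
  by split; apply: (lt_le_trans hdq); rewrite ge_min lexx ?orbT.
have := hq h; rewrite /= sub0r normrN gtr0_norm// => /(_ hq').
rewrite gt_eqF// => /(_ isT).
rewrite addr0 g0 subr0 [_%:A]mulr1 /GRing.scale/= mulrC ltr_pdivlMr//.
by rewrite ltNge gC// h0 ltW.
Qed.

Lemma cube_compact (R : realType) (n : nat) (z : 'rV[R]_n) (d : R) :
  compact [set x | `|x - z| <= d].
Proof.
apply: bounded_closed_compact.
  exists (`|z| + d); split; first exact: num_real.
  move=> r zr x /= xd; rewrite (le_trans _ (ltW zr))//.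
  by rewrite -[x](subrK z) (le_trans (ler_normD _ _))// addrC lerD2l.
have -> : [set x | `|x - z| <= d] = (fun x => `|x - z|) @^-1` [set r | r <= d].
  by [].
apply: closed_comp => [x _|]; last exact: closed_le.
apply: continuous_comp; last exact: norm_continuous.
by apply: continuousB; [exact: cvg_id | exact: cst_continuous].
Qed.

Lemma is_derive_quadratic (R : realType) (a b c t : R) :
  is_derive t 1 (fun s => a + b * s + c * s ^+ 2) (b + 2 * c * t).
Proof.
have dX : is_derive t 1 (@GRing.exp R ^~ 2) (2 * t).
  by split; [exact: exprn_derivable | rewrite exp_derive [_ *: 1]mulr1 expr1].
rewrite (_ : (fun s => _) =
    cst a + b \*: (@idfun R) + c \*: (@GRing.exp R ^~ 2)); last exact/funext.
rewrite (_ : b + _ = 0 + b *: 1 + c *: (2 * t)); first exact: is_deriveD.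
by rewrite add0r [b *: 1]mulr1 [c *: _]mulrCA mulrA.
Qed.

(** * The first-derivative estimate by odd reflection and a barrier *)

Section odd_reflection.
Context {R : realType} {n : nat}.
Context (z : 'rV[R]_n) (k : 'I_n) (d M : R).

Let refl (x : 'rV[R]_n) : 'rV[R]_n := x - (2 * (x 0 k - z 0 k)) *: delta_mx 0 k.

(* Vanishes at [z], is nonnegative on the half cube [z 0 k <= x 0 k], is at
   least [2 * M] on its faces [`|x 0 i - z 0 i| = d], and is strictly
   superharmonic: the factor [n.+1] beats the [n] squares. *)
Let barrier (x : 'rV[R]_n) : R := 2 * M / d ^+ 2 *
  (\sum_i (x 0 i - z 0 i) ^+ 2 +
   n.+1%:R * ((x 0 k - z 0 k) * (d - (x 0 k - z 0 k)))).

Let refl_coord (x : 'rV[R]_n) i : refl x 0 i - z 0 i =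
  if i == k then - (x 0 i - z 0 i) else x 0 i - z 0 i.
Proof.
rewrite !mxE eqxx /=; case: eqP => [->|_]; last by rewrite mulr0 subr0.
by rewrite mulr1; ring.
Qed.

Let refl_line (x : 'rV[R]_n) i t : refl (x + t *: delta_mx 0 i) =
  refl x + ((if i == k then -1 else 1) * t) *: delta_mx 0 i.
Proof.
rewrite /refl !mxE eqxx /= [k == i]eq_sym.
case: eqP => [->|_]; last first.
  by rewrite mulr0 addr0 mul1r addrAC.
rewrite mulr1 -!addrA; congr (x + _).
by rewrite -!scaleNr -!scalerDl; congr (_ *: _); rewrite /GRing.scale/=; ring.
Qed.

Let refl_norm (x : 'rV[R]_n) : `|x - z| <= d -> `|refl x - z| <= d.
Proof.
move=> xd; have d0 : 0 <= d by rewrite (le_trans _ xd).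
apply: rV_norm_le => // i.
have -> : (refl x - z) 0 i = refl x 0 i - z 0 i by rewrite !mxE.
rewrite refl_coord.
have := coord_norm_le _ _ (x - z) i; rewrite !mxE => xi.
by case: ifP => _; rewrite ?normrN (le_trans xi).
Qed.

(** On each coordinate line the barrier is a quadratic polynomial, so its second partial derivative
    is twice the coefficient of [t ^+ 2]. *)
Let barrier_line (x : 'rV[R]_n) i t :
  barrier (x + t *: delta_mx 0 i) = barrier x +
  2 * M / d ^+ 2 * (2 * (x 0 i - z 0 i) +
    (if i == k then n.+1%:R * (d - 2 * (x 0 k - z 0 k)) else 0)) * t +
  2 * M / d ^+ 2 * (1 - if i == k then n.+1%:R else 0) * t ^+ 2.
Proof.
rewrite /barrier -!mulrA -!mulrDr; congr (_ * (_ * _)).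
rewrite (bigD1 i)//= [in RHS](bigD1 i)//=.
rewrite [in LHS](eq_bigr (fun j => (x 0 j - z 0 j) ^+ 2)); last first.
  by move=> j /negPf ji; rewrite !mxE eqxx ji /= mulr0 addr0.
rewrite !mxE !eqxx [k == i]eq_sym /=; case: eqP => [->|_] /=; ring.
Qed.

Let barrier_ge0 (x : 'rV[R]_n) :
  0 <= M -> 0 <= x 0 k - z 0 k <= d -> 0 <= barrier x.
Proof.
move=> M0 /andP[y0 yd]; rewrite /barrier mulr_ge0//.
  by rewrite divr_ge0 ?sqr_ge0// mulr_ge0.
rewrite addr_ge0 ?sumr_ge0// => [i _|]; first exact: sqr_ge0.
by rewrite !mulr_ge0// subr_ge0.
Qed.

(** The square of coordinate [i] alone is at least [d ^+ 2], and the other terms are nonnegative. *)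
Let barrier_face (x : 'rV[R]_n) i :
  0 <= M -> 0 < d -> 0 <= x 0 k - z 0 k <= d ->
  d <= `|x 0 i - z 0 i| -> 2 * M <= barrier x.
Proof.
move=> M0 d0 /andP[y0 yd] di; rewrite /barrier -mulrA ler_peMr ?mulr_ge0//.
rewrite mulrC ler_pdivlMr ?exprn_gt0// mul1r (bigD1 i)//= -addrA.
rewrite -[leLHS]addr0 lerD//.
  by rewrite -[leRHS]real_normK ?num_real// lerXn2r ?nnegrE ?(ltW d0).
rewrite addr_ge0 ?sumr_ge0// => [j _|]; first exact: sqr_ge0.
by rewrite !mulr_ge0// subr_ge0.
Qed.

(** On its side [x 0 k = z 0 k] the odd difference [f x - f (refl x)] vanishes; on its other faces
    the barrier is at least [2 * M], which bounds that difference. *)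
Let halfcube := [set x : 'rV[R]_n | `|x - z| <= d /\ z 0 k <= x 0 k].

Let halfcube_compact : compact halfcube.
Proof.
have -> : halfcube = [set x | `|x - z| <= d] `&`
    (fun x : 'rV[R]_n => x 0 k) @^-1` [set r | z 0 k <= r] by [].
apply: compact_closedI; first exact: cube_compact.
apply: closed_comp => [x _|]; [exact: coord_continuous | exact: closed_ge].
Qed.

Let shift_coord_continuous i : continuous (fun x : 'rV[R]_n => x 0 i - z 0 i).
Proof.
move=> x.
by apply: continuousB; [exact: coord_continuous | exact: cst_continuous].
Qed.

Let barrier_continuous : continuous barrier.
Proof.
have cc i x := @shift_coord_continuous i x.
have csum : continuous (fun x : 'rV[R]_n => \sum_i (x 0 i - z 0 i) ^+ 2).
  apply: (@continuous_big _ _ _ _ predT); first exact: add_continuous.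
  by move=> i _ y; exact: (continuousM (cc i y) (cc i y)).
move=> x.
have cB : {for x, continuous (fun y : 'rV[R]_n => d - (y 0 k - z 0 k))}.
  by apply: continuousB; [exact: cst_continuous | exact: cc].
have cst c := @cst_continuous 'rV[R]_n R c x.
exact: (continuousM (cst _) (continuousD (csum x)
  (continuousM (cst _) (continuousM (cc k x) cB)))).
Qed.

(** Maximum principle for [W], the signed odd difference minus the barrier. A positive maximum over
    the half cube would be interior, but there [W] is strictly subharmonic, so its second
    derivatives along the axes cannot all be nonpositive. *)
Lemma odd_difference_le (D : set 'rV[R]_n) (f : 'rV[R]_n -> R) (sg t : R) :
  harmonic_on D f -> 0 < d -> 0 < M ->
  (forall x, `|x - z| <= d -> D x) ->
  (forall x, `|x - z| <= d -> `|f x| <= M) -> `|sg| <= 1 -> 0 <= t <= d ->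
  sg * (f (z + t *: delta_mx 0 k) - f (z + (-1 * t) *: delta_mx 0 k)) <=
    2 * M * n.+1%:R / d * t.
Proof.
move=> [sf lf] d0 M0 zD fM sg1 /andP[t0 td].
pose W (x : 'rV[R]_n) := sg * (f x - f (refl x)) - barrier x.
suff Wle0 (x : 'rV[R]_n) : halfcube x -> W x <= 0.
  have reflz : refl z = z by rewrite /refl subrr mulr0 scale0r subr0.
  have barrierz : barrier z = 0.
    rewrite /barrier subrr mul0r mulr0 addr0 big1 ?mulr0// => i _.
    by rewrite subrr expr0n.
  have Kt : halfcube (z + t *: delta_mx 0 k).
    split; last by rewrite !mxE !eqxx mulr1 lerDl.
    rewrite addrAC subrr add0r normrZ (ger0_norm t0).
    by rewrite (le_trans _ td)// ler_piMr// norm_delta_le1.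
  have := Wle0 _ Kt; rewrite /W refl_line barrier_line eqxx reflz barrierz.
  rewrite subr_le0 => /le_trans; apply.
  (* On the axis through [z] the barrier falls short of the linear bound by exactly its quadratic
     term. *)
  rewrite -subr_ge0 (_ : _ - _ = 2 * M / d ^+ 2 * n%:R * t ^+ 2).
    by rewrite !mulr_ge0 ?invr_ge0 ?sqr_ge0// ltW.
  by rewrite -[n.+1]addn1 natrD; field; rewrite gt_eqF.
move=> Kx; rewrite leNgt; apply/negP => Wx0.
have cW : {within halfcube, continuous W}.
  apply: continuous_in_subspaceT => u; rewrite inE => -[ud _].
  have cu : {for u, continuous f} by apply: smooth_continuous sf (zD _ ud).
  have cru : {for refl u, continuous f}.
    by apply: smooth_continuous sf (zD _ (refl_norm _ ud)).
  have crefl : {for u, continuous refl}.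
    apply: continuousB; first exact: cvg_id.
    apply: continuousZ; last exact: cst_continuous.
    apply: continuousM; first exact: cst_continuous.
    exact: shift_coord_continuous.
  have cb := @barrier_continuous u.
  have cfr : {for u, continuous (f \o refl)} by exact: continuous_comp.
  have csg := @cst_continuous 'rV[R]_n R sg u.
  exact: (continuousB (continuousM csg (continuousB cu cfr)) cb).
have [y yK Wmax] := compact_EVT_max (ex_intro _ x Kx) halfcube_compact cW.
have Wy0 : 0 < W y by rewrite (lt_le_trans Wx0)// Wmax// inE.
have {yK}[yd yk] : halfcube y by rewrite inE in yK.
have sgf : sg * (f y - f (refl y)) <= 2 * M.
  rewrite (le_trans (ler_norm _))// normrM -[leRHS]mul1r ler_pM//.
  rewrite (le_trans (ler_normB _ _))// mulr_natl mulr2n lerD// fM//.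
  exact: refl_norm.
have ykd : y 0 k - z 0 k <= d.
  by rewrite (le_trans (ler_norm _))// (le_trans _ yd)//
    -[y 0 k - z 0 k](_ : (y - z) 0 k = _) ?coord_norm_le// !mxE.
(* On the mirror [refl y = y], so [W y] would be minus the barrier. *)
have yk0 : 0 < y 0 k - z 0 k.
  rewrite lt_neqAle subr_ge0 yk andbT; apply/negP => /eqP yk0.
  move: Wy0; rewrite /W /refl -yk0 mulr0 scale0r subr0 subrr mulr0 sub0r.
  by rewrite oppr_gt0 ltNge barrier_ge0 ?(ltW M0)// -yk0 lexx ltW.
(* On a face the barrier would absorb the bound [sgf]. *)
have {}yd : `|y - z| < d.
  apply: rV_norm_lt => // i; rewrite ltNge; apply/negP => di.
  have : 2 * M <= barrier y.
    apply: (barrier_face y i (ltW M0) d0); first by rewrite (ltW yk0).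
    by move: di; rewrite !mxE.
  by move=> /(le_trans sgf); rewrite -subr_le0 leNgt => /negP; exact.
pose q i : R := 2 * M / d ^+ 2 * (1 - if i == k then n.+1%:R else 0).
have d2W i : sg * (partial i (partial i f) y - partial i (partial i f) (refl y))
    - 2 * q i <= 0.
  pose e : 'rV[R]_n := delta_mx 0 i.
  pose s : R := if i == k then -1 else 1.
  pose b := 2 * M / d ^+ 2 * (2 * (y 0 i - z 0 i) +
    (if i == k then n.+1%:R * (d - 2 * (y 0 k - z 0 k)) else 0)).
  pose P r := barrier y + b * r + q i * r ^+ 2.
  (* A lower bound for the distance from [y] to the mirror and to the faces: the axis line through
     [y] stays in the half cube for parameters below [eta]. *)
  pose eta := Num.min (d - `|y - z|) (y 0 k - z 0 k).
  have eta0 : 0 < eta by rewrite lt_min subr_gt0 yd.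
  have nearK : \forall r \near (0 : R), halfcube (y + r *: e).
    apply/nbhs_ballP; exists eta => // r.
    rewrite -ball_normE /= sub0r normrN lt_min => /andP[rd rk]; split.
      rewrite addrAC (le_trans (ler_normD _ _))// -lerBrDl.
      rewrite (le_trans _ (ltW rd))//.
      by rewrite normrZ ler_piMr// norm_delta_le1.
    have ek : `|(e : 'rV[R]_n) 0 k| <= 1.
      exact: le_trans (coord_norm_le _ _ _ _) (norm_delta_le1 _ _ _).
    have -> : (y + r *: e) 0 k = y 0 k + r * e 0 k by rewrite !mxE.
    rewrite -subr_ge0 addrAC -lerBlDr sub0r.
    rewrite (le_trans _ (ltW rk))// (le_trans (ler_norm _))// normrN normrM.
    by rewrite ler_piMr.
  have nearball : \forall r \near (0 : R),
      `|y + r *: e - z| <= d /\ `|refl y + (s * r) *: e - z| <= d.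
    apply: filterS nearK => r [yrd _]; split=> //.
    by rewrite /s -refl_line refl_norm.
  pose g r := sg * (f (y + r *: e) - f (refl y + (s * r) *: e)) - P r.
  pose dg r := sg * (partial i f (y + r *: e) -
    partial i f (refl y + (s * r) *: e) * s) - (b + 2 * q i * r).
  have sfi := smooth_partial _ _ _ _ _ i sf.
  (* The sign from the reflection enters once per derivative, so it disappears from the second
     one. *)
  have ss : s * s = 1 by rewrite /s; case: ifP => _; rewrite ?mulrNN mulr1.
  apply: (second_derivative_test _ g dg).
  - apply: filterS nearball => r [yr ryr].
    apply: is_deriveB; last exact: is_derive_quadratic.
    apply: is_deriveZ; apply: is_deriveB.
      by apply: is_derive_line; exact: smooth_derivable sf (zD _ yr).
    by apply: is_derive_line_scale; exact: smooth_derivable sf (zD _ ryr).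
  - have [] := nbhs_singleton nearball; rewrite mulr0 !scale0r !addr0 => y0 ry0.
    have dP : is_derive (0 : R) (1 : R) (fun r => b + 2 * q i * r) (2 * q i).
      have := is_derive_quadratic R b (2 * q i) 0 0.
      rewrite mulr0 addr0; congr is_derive; apply/funext => r.
      by rewrite mul0r addr0.
    have d1 : is_derive (0 : R) (1 : R) (fun r => partial i f (y + r *: e))
        (partial i (partial i f) y).
      have := is_derive_line _ _ _ (partial i f) y e 0; rewrite scale0r addr0.
      by apply; exact: smooth_derivable sfi (zD _ y0).
    have d2 : is_derive (0 : R) (1 : R)
        (fun r => partial i f (refl y + (s * r) *: e) * s)
        (partial i (partial i f) (refl y)).
      have := is_derive_line_scale _ _ (partial i f) (refl y) e s 0.
      rewrite mulr0 scale0r addr0.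
      set F := (F in is_derive _ _ F _).
      move=> /(_ (smooth_derivable _ _ _ _ _ _ _ sfi (zD _ ry0))) dF.
      have : is_derive (0 : R) (1 : R) (s \*: F)
          (s *: (partial i (partial i f) (refl y) * s)) by exact: is_deriveZ.
      rewrite [s *: _]mulrCA ss mulr1; congr is_derive.
      by apply/funext => r; exact: mulrC.
    apply: is_deriveB => //; apply: is_deriveZ; exact: is_deriveB.
  - apply: filterS nearK => r Kr.
    have gE r' : g r' = W (y + r' *: e).
      by rewrite /g /W refl_line /P barrier_line.
    by rewrite !gE scale0r addr0 Wmax// inE.
(* The sum contains the Laplacians of [f] at [y] and [refl y], both zero, and [- 2 * \sum_i q i].
   Since [\sum_i q i = - (2 * M / d ^+ 2)], it is positive: a contradiction. *)
have : \sum_i (sg * (partial i (partial i f) y -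
    partial i (partial i f) (refl y)) - 2 * q i) <= 0.
  by apply: sumr_le0 => i _; exact: d2W.
have Dy : D y by apply/zD/ltW.
have Dry : D (refl y) by apply/zD/refl_norm/ltW.
have -> : \sum_i (sg * (partial i (partial i f) y -
      partial i (partial i f) (refl y)) - 2 * q i) =
    sg * (laplacian f y - laplacian f (refl y)) - 2 * \sum_i q i.
  by rewrite sumrB -!mulr_sumr sumrB.
rewrite (lf _ Dy) (lf _ Dry) subrr mulr0 sub0r -mulr_sumr sumrB.
rewrite sumr_const card_ord.
rewrite (bigD1 k)//= eqxx big1 => [|i /negPf->//].
rewrite addr0 -[n.+1]addn1 natrD opprD addNKr mulrN1 mulrN opprK leNgt => /negP.
by apply; rewrite mulr_gt0// divr_gt0 ?exprn_gt0// mulr_gt0.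
Qed.

End odd_reflection.

(** The odd difference has derivative [2 * (sg * partial k f z)] at [t = 0], and its slope is at
    most [2 * M * n.+1%:R / d]. The signs 1 and -1 give the absolute value. *)
Lemma harmonic_partial_le (R : realType) (n : nat) (D : set 'rV[R]_n)
    (f : 'rV[R]_n -> R) (z : 'rV[R]_n) (k : 'I_n) (d M : R) :
  harmonic_on D f -> 0 < d -> 0 < M -> (forall x, `|x - z| <= d -> D x) ->
  (forall x, `|x - z| <= d -> `|f x| <= M) ->
  `|partial k f z| <= n.+1%:R / d * M.
Proof.
move=> hf d0 M0 zD fM.
have Dz : D z by apply: zD; rewrite subrr normr0 ltW.
have df := smooth_derivable _ _ _ _ _ _ k hf.1 Dz.
pose e : 'rV[R]_n := delta_mx 0 k.
have signed (sg : R) : `|sg| <= 1 -> sg * partial k f z <= n.+1%:R / d * M.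
  move=> sg1.
  pose g t := sg * (f (z + t *: e) - f (z + (-1 * t) *: e)).
  have dg : is_derive (0 : R) (1 : R) g
      (sg * (partial k f z - partial k f z * -1)).
    apply: is_deriveZ; apply: is_deriveB.
      have := is_derive_line _ _ _ f z e 0.
      by rewrite scale0r addr0; apply.
    have := is_derive_line_scale _ _ f z e (-1) 0.
    by rewrite mulr0 scale0r addr0; apply.
  have g0 : g 0 = 0 by rewrite /g mulr0 scale0r subrr mulr0.
  have le2 : sg * (partial k f z - partial k f z * -1) <= 2 * M * n.+1%:R / d.
    apply: (derive_le_of_slope _ _ _ _ _ d0 dg g0) => t /andP[t0 td].
    by apply: (odd_difference_le _ _ _ _ D) => //; rewrite (ltW t0).
  rewrite -(ler_pM2l (ltr0Sn R 1)).
  have -> : 2 * (sg * partial k f z) =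
    sg * (partial k f z - partial k f z * -1) by ring.
  by rewrite (le_trans le2)// le_eqVlt; apply/orP/or_introl/eqP; ring.
rewrite ler_norml; apply/andP; split.
  by rewrite lerNl -mulN1r signed// normrN normr1.
by rewrite -[leLHS]mul1r signed// normr1.
Qed.

(** * Estimates of higher derivatives *)

Lemma iter_harmonic_partial (R : realType) (n : nat) (D : set 'rV[R]_n)
    (f : 'rV[R]_n -> R) (k : 'I_n) (j : nat) :
  open D -> harmonic_on D f -> harmonic_on D (iter j (partial k) f).
Proof.
move=> oD hf; elim: j => [|j IH]; first exact: hf.
exact: (harmonic_partial _ _ _ _ k oD IH).
Qed.

(** Each derivative costs a layer of thickness [delta] and a factor [n.+1%:R / delta]. [M] and [f]
    are quantified late so that the induction hypothesis applies to [partial k f] with its larger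
    bound. *)
Lemma iter_harmonic_partial_le (R : realType) (n : nat) (D : set 'rV[R]_n)
    (z : 'rV[R]_n) (k : 'I_n) (j : nat) (rho delta : R) :
  open D -> 0 < delta -> 0 <= rho ->
  (forall x, `|x - z| <= rho + j%:R * delta -> D x) ->
  forall (M : R) (f : 'rV[R]_n -> R), harmonic_on D f -> 0 < M ->
  (forall x, `|x - z| <= rho + j%:R * delta -> `|f x| <= M) ->
  forall x, `|x - z| <= rho ->
    `|iter j (partial k) f x| <= (n.+1%:R / delta) ^+ j * M.
Proof.
move=> oD de0 rho0; elim: j => [|j IH] zD M f hf M0 fM x xrho.
  by rewrite expr0 mul1r fM// mul0r addr0.
have nest y : `|y - z| <= rho + j%:R * delta ->
    forall v, `|v - y| <= delta -> `|v - z| <= rho + j.+1%:R * delta.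
  move=> yz v vy; rewrite -(subrKA y) (le_trans (ler_normD _ _))//.
  by rewrite -natr1 mulrDl mul1r addrA [leRHS]addrC lerD.
have C0 : 0 < n.+1%:R / delta :> R by rewrite divr_gt0.
have nestD y : `|y - z| <= rho + j%:R * delta -> D y.
  by move=> yz; apply: zD; apply: (nest y yz); rewrite subrr normr0 ltW.
have bound y : `|y - z| <= rho + j%:R * delta ->
    `|partial k f y| <= n.+1%:R / delta * M.
  move=> yz; apply: (harmonic_partial_le _ _ _ _ _ _ _ _ hf de0 M0).
    by move=> v vy; apply: zD; exact: (nest y).
  by move=> v vy; apply: fM; exact: (nest y).
rewrite iterSr exprSr -mulrA.
exact: (IH nestD _ _ (harmonic_partial _ _ _ _ k oD hf) (mulr_gt0 C0 M0) bound).
Qed.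

(** Each of the [k] factors of the falling factorial of [2k] is at least [k], and that product is
    [k!] times a central binomial coefficient, itself one term in the expansion of
    [(1 + 1) ^ (2k)]. *)
Lemma expnn_le_fact (k : nat) : (k ^ k <= 4 ^ k * k`!)%N.
Proof.
have le_ffact : (k ^ k <= k.*2 ^_ k)%N.
  rewrite ffact_prod -[X in (_ ^ X)%N]card_ord -prod_nat_const.
  by apply: leq_prod => i _; rewrite -addnn -addnBA ?leq_addr// ltnW.
rewrite (leq_trans le_ffact)// -bin_ffact leq_mul2r; apply/orP; right.
rewrite (_ : (4 ^ k = 2 ^ k.*2)%N); last by rewrite -mul2n expnM.
rewrite -[2%N]/(1 + 1)%N expnDn.
have kk : (k < k.*2.+1)%N by rewrite ltnS -addnn leq_addr.
rewrite (bigD1 (Ordinal kk))//= !exp1n !muln1.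
exact: leq_addr.
Qed.

Lemma continuous_cube_bound (R : realType) (n : nat) (D : set 'rV[R]_n)
    (f : 'rV[R]_n -> R) (z : 'rV[R]_n) (r : R) :
  0 <= r -> (forall x, `|x - z| <= r -> D x) ->
  (forall x, D x -> {for x, continuous f}) ->
  exists2 M, 0 < M & forall x, `|x - z| <= r -> `|f x| <= M.
Proof.
move=> r0 zD cf.
have cnf : {within [set x | `|x - z| <= r], continuous (fun x => `|f x|)}.
  apply: continuous_in_subspaceT => x; rewrite inE => /zD/cf cfx.
  by apply: continuous_comp; [exact: cfx | exact: norm_continuous].
have z_in : [set x | `|x - z| <= r] !=set0.
  by exists z; rewrite /= subrr normr0.
have [c _ cmax] := compact_EVT_max z_in (cube_compact _ _ z r) cnf.
exists (`|f c| + 1) => [|x xr]; first by rewrite ltr_wpDl.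
by rewrite (le_trans (cmax x _)) ?inE// lerDl.
Qed.

Lemma eq0_of_geometric_bound (R : realType) (a M : R) :
  (forall K, (0 < K)%N -> `|a| <= M / 2 ^+ K) -> a = 0.
Proof.
move=> aM; apply/eqP/negPn/negP => a0.
have na0 : 0 < `|a| by rewrite normr_gt0.
have M0 : 0 <= M.
  have := le_trans (ltW na0) (aM 1%N isT).
  by rewrite pmulr_lge0// invr_gt0 exprn_gt0.
pose K := (Num.bound (M / `|a|)).+1.
have : M / `|a| < 2 ^+ K.
  rewrite (lt_trans (archi_boundP _)) ?divr_ge0//.
  by rewrite -natrX ltr_nat (leq_ltn_trans (leqnSn _))// ltn_expl.
rewrite ltr_pdivrMr// mulrC -ltr_pdivrMr ?exprn_gt0// => lt_a.
by have := lt_le_trans lt_a (aM K isT); rewrite ltxx.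
Qed.

(** * Propagation of zeros and unique continuation *)

(** All derivatives of [f] vanish at [z], so Taylor's bound at order [K] leaves only the remainder.
    It is at most [M / 2 ^+ K], and [K] is arbitrary. *)
Lemma harmonic_eq0_line (R : realType) (n : nat) (D : set 'rV[R]_n)
    (f : 'rV[R]_n -> R) (z : 'rV[R]_n) (k : 'I_n) (r t : R) :
  open D -> harmonic_on D f -> 0 < r -> (forall x, `|x - z| <= r -> D x) ->
  (\forall x \near z, f x = 0) -> `|t| <= r / (16 * n.+1%:R) ->
  f (z + t *: delta_mx 0 k) = 0.
Proof.
move=> oD hf r0 zD f0 tr.
have C0 : 0 < n.+1%:R :> R by [].
have [M M0 fM] : exists2 M, 0 < M & forall x, `|x - z| <= r -> `|f x| <= M.
  apply: (continuous_cube_bound _ _ _ _ _ _ (ltW r0) zD) => x Dx.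
  exact: smooth_continuous hf.1 Dx.
apply: (eq0_of_geometric_bound _ _ M) => K K0.
pose e : 'rV[R]_n := delta_mx 0 k.
pose s : R := if t < 0 then -1 else 1.
have st : s * `|t| = t.
  by rewrite /s; case: ltrP => t0; [rewrite ltr0_norm// mulrNN mul1r |
    rewrite ger0_norm// mul1r].
have s1 : `|s| = 1 by rewrite /s; case: ifP => _; rewrite ?normrN normr1.
have K0R : 0 < K%:R :> R by rewrite ltr0n.
have tr2 : `|t| <= r / 2.
  rewrite (le_trans tr)// ler_pM2l// lef_pV2 ?posrE ?mulr_gt0//.
  by rewrite -natrM ler_nat (@leq_trans 16)// leq_pmulr.
(* [K] layers of this thickness fill the gap between the cube of radius [r / 2], which contains the
   segment, and that of radius [r]. *)
pose delta := r / (2 * K%:R).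
have delta0 : 0 < delta by rewrite divr_gt0// mulr_gt0.
have rE : r / 2 + K%:R * delta = r.
  by rewrite /delta; field; rewrite gt_eqF.
have line_in (y : R) : 0 <= y <= `|t| -> `|z + (s * y) *: e - z| <= r / 2.
  move=> /andP[y0 yt]; rewrite addrAC subrr add0r normrZ normrM s1 mul1r.
  rewrite ger0_norm// (le_trans _ tr2)// (le_trans _ yt)// ler_piMr//.
  exact: norm_delta_le1.
have line_D (y : R) : 0 <= y <= `|t| -> D (z + (s * y) *: e).
  move=> /line_in yr; apply: zD; rewrite (le_trans yr)//.
  by rewrite ler_pdivrMr// ler_peMr ?ler1n// ltW.
pose g j y := s ^+ j * iter j (partial k) f (z + (s * y) *: e).
have dg (j : nat) (y : R) : (j < K)%N -> 0 <= y <= `|t| ->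
    is_derive y 1 (g j) (g j.+1 y).
  move=> _ /line_D Dy.
  have [sj _] := iter_harmonic_partial _ _ _ _ k j oD hf.
  have dj := is_derive_line_scale _ _ _ _ _ _ _
    (smooth_derivable _ _ _ _ _ _ k sj Dy).
  have : is_derive y 1 (g j)
      (s ^+ j *: ('D_(delta_mx 0 k) (iter j (partial k) f)
        (z + (s * y) *: delta_mx 0 k) * s)) by exact: is_deriveZ.
  by rewrite [s ^+ j *: _]mulrC -mulrA -exprS mulrC.
have g0 j : (j < K)%N -> g j 0 = 0.
  move=> _; rewrite /g mulr0 scale0r addr0.
  suff : \forall x \near z, iter j (partial k) f x = 0.
    by move=> /nbhs_singleton ->; rewrite mulr0.
  elim: j => [|j IH]; first exact: f0.
  exact: partial_near0.
have gK (y : R) : 0 <= y <= `|t| -> `|g K y| <= (n.+1%:R / delta) ^+ K * M.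
  move=> yt; rewrite /g normrM normrX s1 expr1n mul1r.
  apply: (iter_harmonic_partial_le _ _ _ z k K (r / 2) delta oD delta0) => //.
  - by rewrite divr_ge0// ltW.
  - by move=> x; rewrite rE; exact: zD.
  - by move=> x; rewrite rE; exact: fM.
  - exact: line_in.
have t0t : 0 <= `|t| <= `|t| by rewrite normr_ge0 lexx.
have := taylor_bound _ _ _ _ _ dg g0 gK _ t0t.
rewrite /g /= expr0 mul1r st => /le_trans; apply.
have fK0 : 0 < K`!%:R :> R by rewrite ltr0n fact_gt0.
(* The constant 16 is chosen for this 8: [8 ^+ K] splits into [4 ^+ K], spent on [expnn_le_fact],
   and [2 ^+ K], the decay that remains. *)
have rate : n.+1%:R / delta * `|t| <= K%:R / 8.
  rewrite /delta invf_div mulrA mulrAC ler_pdivrMr//.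
  rewrite (_ : K%:R / 8 * r =
    n.+1%:R * (2 * K%:R) * (r / (16 * n.+1%:R))); last first.
    by field; rewrite nat1r gt_eqF.
  by apply: ler_wpM2l; [rewrite mulr_ge0 ?mulr_ge0 ?ler0n | exact: tr].
have -> : (n.+1%:R / delta) ^+ K * M / K`!%:R * `|t| ^+ K =
    M * (n.+1%:R / delta * `|t|) ^+ K / K`!%:R.
  by rewrite [in RHS]exprMn mulrAC [_ * M]mulrC -!mulrA.
apply: (@le_trans _ _ (M * (K%:R / 8) ^+ K / K`!%:R)).
  rewrite ler_pM2r ?invr_gt0// ler_pM2l// lerXn2r ?nnegrE//.
    by rewrite mulr_ge0// divr_ge0// ltW.
  by rewrite divr_ge0.
rewrite ler_pdivrMr// -mulrA ler_pM2l// expr_div_n ler_pdivrMr ?exprn_gt0//.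
have -> : (2 ^+ K)^-1 * K`!%:R * 8 ^+ K = 4 ^+ K * K`!%:R :> R.
  have -> : 8 = 2 * 4 :> R by rewrite -natrM.
  by rewrite exprMn mulrAC mulrA mulVf ?mul1r// expf_neq0// pnatr_eq0.
by rewrite -!natrX -natrM ler_nat expnn_le_fact.
Qed.

(** The previous lemma is applied from every point near [z], with the cube of radius [r / 2] around
    that point; halving the radius turns 16 into 32. *)
Lemma harmonic_near0_line (R : realType) (n : nat) (D : set 'rV[R]_n)
    (f : 'rV[R]_n -> R) (z : 'rV[R]_n) (k : 'I_n) (r t : R) :
  open D -> harmonic_on D f -> 0 < r -> (forall x, `|x - z| <= r -> D x) ->
  (\forall x \near z, f x = 0) -> `|t| <= r / (32 * n.+1%:R) ->
  \forall x \near (z + t *: delta_mx 0 k), f x = 0.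
Proof.
move=> oD hf r0 zD f0 tr; pose e : 'rV[R]_n := delta_mx 0 k.
have r20 : 0 < r / 2 by rewrite divr_gt0.
have near_z : \forall y \near z,
    `|y - z| <= r / 2 /\ \forall x \near y, f x = 0.
  apply: filterI; last by move/nbhs_interior: f0.
  apply/nbhs_ballP; exists (r / 2) => // y.
  by rewrite -ball_normE /= distrC => /ltW.
have cont : {for z + t *: e, continuous (fun x : 'rV[R]_n => x - t *: e)}.
  by apply: continuousB; [exact: cvg_id | exact: cst_continuous].
have back :
    (fun x : 'rV[R]_n => x - t *: e) @ (z + t *: e) --> z + t *: e - t *: e.
  exact: cont.
rewrite addrK in back.
have near_back : \forall x \near z + t *: e,
    `|x - t *: e - z| <= r / 2 /\ \forall y \near x - t *: e, f y = 0.
  exact: (back _ near_z).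
apply: filterS near_back => x [xz fx0].
rewrite -[x](subrK (t *: e)).
apply: (harmonic_eq0_line _ _ D _ _ _ (r / 2)) => //.
  move=> v vx; apply: zD; rewrite -(subrKA (x - t *: e)) (splitr r).
  by rewrite (le_trans (ler_normD _ _))// lerD.
rewrite (le_trans tr)// le_eqVlt; apply/orP/or_introl/eqP.
by field; rewrite nat1r pnatr_eq0.
Qed.

(** [path] leads from [w] to [z] by replacing one coordinate at a time, each move being at most
    [|w - z|]. Its vertices stay within [r / 2] of [z], so a radius [r / 2] is available at each of
    them, and 32 becomes 64. *)
Lemma harmonic_near0_closed (R : realType) (n : nat) (D : set 'rV[R]_n)
    (f : 'rV[R]_n -> R) (z w : 'rV[R]_n) (r : R) :
  open D -> harmonic_on D f -> 0 < r -> (forall x, `|x - z| <= r -> D x) ->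
  (\forall x \near w, f x = 0) -> `|w - z| <= r / (64 * n.+1%:R) ->
  \forall x \near z, f x = 0.
Proof.
move=> oD hf r0 zD f0 wz.
pose path m : 'rV[R]_n := \row_i (if (i < m)%N then z 0 i else w 0 i).
have coord_wz i : `|w 0 i - z 0 i| <= `|w - z|.
  by have := coord_norm_le _ _ (w - z) i; rewrite !mxE.
have path_close m : `|path m - z| <= r / 2.
  rewrite (@le_trans _ _ `|w - z|)//.
    apply: rV_norm_le => // i; rewrite !mxE.
    case: ifP => _; last exact: coord_wz.
    by rewrite subrr normr0.
  rewrite (le_trans wz)// ler_pM2l// lef_pV2 ?posrE ?mulr_gt0//.
  by rewrite -natrM ler_nat (@leq_trans 64)// leq_pmulr.
have path_near0 m : (m <= n)%N -> \forall x \near path m, f x = 0.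
  elim: m => [_|m IH mn].
    have -> // : path 0%N = w by apply/rowP => i; rewrite mxE.
  pose k := Ordinal mn.
  have -> : path m.+1 = path m + (z 0 k - w 0 k) *: delta_mx 0 k.
    apply/rowP => i; rewrite !mxE eqxx /= ltnS leq_eqVlt.
    have [->|ik] := eqVneq i k; first by rewrite eqxx ltnn /= mulr1 addrC subrK.
    have -> : (nat_of_ord i == m) = false.
      by apply: contraNF ik => /eqP im; apply/eqP/val_inj.
    by rewrite mulr0 addr0.
  apply: (harmonic_near0_line _ _ D _ _ _ (r / 2)) => //.
  - by rewrite divr_gt0.
  - move=> x xp; apply: zD; rewrite -(subrKA (path m)) (splitr r).
    by rewrite (le_trans (ler_normD _ _))// lerD.
  - exact: IH (ltnW mn).
  - rewrite distrC (le_trans (coord_wz k))// (le_trans wz)// le_eqVlt.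
    by apply/orP/or_introl/eqP; field; rewrite nat1r pnatr_eq0.
have -> : z = path n by apply/rowP => i; rewrite mxE ltn_ord.
exact: path_near0.
Qed.

(** Within [D], the interior [Z] of the zero set is nonempty, open and equal to its own closure, so
    connectedness makes it all of [D]. *)
Lemma harmonic_unique_continuation (R : realType) (n : nat)
    (D U : set 'rV[R]_n) (f : 'rV[R]_n -> R) :
  open D -> connected D -> harmonic_on D f ->
  open U -> U !=set0 -> U `<=` D -> (forall x, U x -> f x = 0) ->
  forall x, D x -> f x = 0.
Proof.
move=> oD cD hf oU [x0 Ux0] UD fU.
pose Z := [set x | f x = 0]°.
suff <- : D `&` Z = D by move=> x [_ /nbhs_singleton].
apply: cD.
- exists x0; split; first exact: UD.
  exact: filterS fU (open_nbhs_nbhs (conj oU Ux0)).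
- by exists Z => //; exact: open_interior.
exists (closure Z); first exact: closed_closure.
apply/seteqP; split=> [x [Dx Zx]|z [Dz cZz]]; split=> //.
  exact: subset_closure.
have /nbhs_ballP[r /= r0 rD] := open_nbhs_nbhs (conj oD Dz).
have r20 : 0 < r / 2 by rewrite divr_gt0.
have zD x : `|x - z| <= r / 2 -> D x.
  move=> xz; apply: rD; rewrite -ball_normE /= distrC (le_lt_trans xz)//.
  by rewrite ltr_pdivrMr// ltr_pMr// ltr1n.
have eta0 : 0 < r / 2 / (64 * n.+1%:R) by rewrite divr_gt0// mulr_gt0.
(* A point of [Z] this close to [z] is within reach of [harmonic_near0_closed]. *)
have [w [Zw]] := cZz _ (nbhsx_ballx z _ eta0).
rewrite -ball_normE /= distrC => /ltW wz.
exact: (harmonic_near0_closed _ _ _ _ _ _ _ oD hf r20 zD Zw wz).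
Qed.

(** * The Stokes system *)

Lemma laplacian_eq0 (R : realType) (n : nat) (D : set 'rV[R]_n)
    (f : 'rV[R]_n -> R) (x : 'rV[R]_n) :
  open D -> (forall y, D y -> f y = 0) -> D x -> laplacian f x = 0.
Proof.
move=> oD f0 Dx.
have partial_eq0 i (g : 'rV[R]_n -> R) : (forall y, D y -> g y = 0) ->
    forall y, D y -> partial i g y = 0.
  move=> g0 y Dy; have := partial_near0 _ _ g i y.
  move=> /(_ (filterS g0 (open_nbhs_nbhs (conj oD Dy)))).
  exact: nbhs_singleton.
rewrite /laplacian big1// => i _.
by apply: (partial_eq0 i) => //; exact: partial_eq0.
Qed.

Lemma laplacian_sum (R : realType) (n m : nat) (D : set 'rV[R]_n)
    (f : 'I_m -> 'rV[R]_n -> R) (x : 'rV[R]_n) :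
  open D -> (forall k, smooth_on D (f k)) -> D x ->
  laplacian (fun y => \sum_k f k y) x = \sum_k laplacian (f k) x.
Proof.
move=> oD sf Dx; rewrite /laplacian exchange_big; apply: eq_bigr => i _ /=.
have sfi k : smooth_on D (partial i (f k)) by exact: smooth_partial.
rewrite -(partial_sum _ _ _ _ _ _ _ sfi Dx).
apply: (eq_partial _ _ _ D) => // y Dy.
exact: (partial_sum _ _ _ _ _ _ _ sf Dy).
Qed.

(** The Laplacian of [du j] is [partial j] of the Laplacian of component [j], that is
    [partial j (partial j p)]. Summing over [j] identifies the Laplacian of [p] with that of
    [divergence u], which is zero. *)
Lemma stokes_pressure_harmonic (R : realType) (n : nat) (D : set 'rV[R]_n)
    (u : 'rV[R]_n -> 'rV[R]_n) (p : 'rV[R]_n -> R) :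
  open D -> (forall j, smooth_on D (fun x => u x 0 j)) -> smooth_on D p ->
  (forall x, D x -> vlaplacian u x = gradient p x) ->
  (forall x, D x -> divergence u x = 0) -> harmonic_on D p.
Proof.
move=> oD su sp stokes divu; split=> [|x Dx]; first exact: sp.
pose du j := partial j (fun y => u y 0 j).
have sdu j : smooth_on D (du j) := smooth_partial _ _ _ _ _ j (su j).
have lap_du j : laplacian (du j) x = partial j (partial j p) x.
  rewrite (laplacian_partial _ _ _ _ _ _ oD (su j) Dx).
  apply: (eq_partial _ _ _ _ _ _ _ _ oD _ Dx) => y Dy.
  by have /rowP/(_ j) := stokes y Dy; rewrite !mxE.
rewrite -(laplacian_eq0 _ _ _ _ _ oD divu Dx).
rewrite [RHS](laplacian_sum _ _ _ _ du _ oD sdu Dx).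
by apply: eq_bigr => j _; rewrite lap_du.
Qed.

(** Connectedness of [Omt] carries the zeros beyond [Om]. On a union of two disjoint balls, [u = 0]
    with [p] equal to 0 on one ball and 1 on the other solves the system without vanishing
    everywhere. *)
Theorem corollary5p3 (R : realType) (Omt : set 'rV[R]_3)
    (Omt_open : open Omt) (Omt_neq0 : Omt !=set0) (Omt_conn : connected Omt)
    (Om : set 'rV[R]_3)
    (Om_open : open Om) (Om_neq0 : Om !=set0) (Om_sub : Om `<=` Omt)
    (u : 'rV[R]_3 -> 'rV[R]_3) (p : 'rV[R]_3 -> R)
    (up_smooth : smooth_on Omt (fun x => (u x, p x)))
    (stokes : forall x, Omt x -> vlaplacian u x = gradient p x)
    (div_free : forall x, Omt x -> divergence u x = 0)
    (up_eq0 : forall x, Om x -> u x = 0 /\ p x = 0) :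
  forall x, Omt x -> u x = 0 /\ p x = 0.
Proof.
have sp : smooth_on Omt p.
  apply: (smooth_linear_comp _ _ _ _ snd _ _ _ _ Omt_open up_smooth) => //.
  by move=> v; exact: cvg_snd.
have su j : smooth_on Omt (fun x => u x 0 j).
  apply: (smooth_linear_comp _ _ _ _ (fun v : 'rV[R]_3 * R => v.1 0 j)
    _ _ _ _ Omt_open up_smooth) => [a v w|v]; first by rewrite !mxE.
  apply: (@continuous_comp _ _ _ fst (fun y : 'rV[R]_3 => y 0 j)).
    exact: cvg_fst.
  exact: coord_continuous.
have hp := stokes_pressure_harmonic _ _ _ _ _ Omt_open su sp stokes div_free.
have p0 : forall x, Omt x -> p x = 0.
  by apply: (harmonic_unique_continuation _ _ _ _ _ Omt_open Omt_conn hp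
    Om_open Om_neq0 Om_sub) => x /up_eq0[].
(* Since [p] vanishes on the open set [Omt], so does its gradient, and the Stokes equation makes
   each component harmonic. *)
have hu j : harmonic_on Omt (fun x => u x 0 j).
  split=> [|x Ox]; first exact: su.
  have /rowP/(_ j) := stokes x Ox; rewrite !mxE => ->.
  have := partial_near0 _ _ p j x.
  move=> /(_ (filterS p0 (open_nbhs_nbhs (conj Omt_open Ox)))).
  exact: nbhs_singleton.
move=> x Ox; split; last exact: p0.
apply/rowP => j; rewrite mxE.
apply: (harmonic_unique_continuation _ _ _ _ _ Omt_open Omt_conn (hu j)
  Om_open Om_neq0 Om_sub) Ox => y /up_eq0[-> _].
by rewrite mxE.
Qed.
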